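(* Let $Q$ be a quiver with vertices $1,\dots,p$ and arrows $\alpha_1,\dots,\alpha_q$. Then the set $D(Q)\subset\mathbb N_0^p$ (defined in the context) is the set of dimensions of indecomposable unitary representations of $Q$; that is, for $z\in\mathbb N_0^p$ there exists an indecomposable unitary representation of $Q$ of dimension $z$ if and only if $z\in D(Q)$.
   Context: A quiver is a finite directed graph (loops and multiple arrows allowed). $\mathbb N_0=\{0,1,2,\dots\}$. A unitary representation of $Q$ of dimension $d=(d_1,\dots,d_p)\in\mathbb N_0^p$ is a sequence $A=(A_{\alpha_1},\dots,A_{\alpha_q})$ assigning to each arrow $\alpha:i\to j$ a matrix $A_\alpha\in\mathbb C^{d_j\times d_i}$ (empty matrices, with zero rows or columns, are allowed). An isometry $A\to B$ of two representations of dimension $d$ is a sequence $S=(S_1,\dots,S_p)$ of unitary $d_i\times d_i$ matrices $S_i$ such that $S_jA_\alpha=B_\alpha S_i$ for each arrow $\alpha:i\to j$; one writes $A\simeq B$ if an isometry exists. The direct sum is $A\oplus B=(A_{\alpha_1}\oplus B_{\alpha_1},\dots,A_{\alpha_q}\oplus B_{\alpha_q})$, where for empty matrices one uses the usual conventions: $M\oplus 0_{0n}$ adds $n$ zero columns, $M\oplus 0_{m0}$ adds $m$ zero rows. A representation $A$ of dimension $d$ is indecomposable if $d\ne(0,\dots,0)$ and $A\simeq B\oplus C$ implies that $B$ or $C$ has dimension $(0,\dots,0)$. $M_Q=[m_{ij}]$ is the $p\times p$ matrix in which $m_{ij}$ is the number of arrows of $Q$ between $i$ and $j$ (of the form $i\to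 j$ or $i\leftarrow j$; each loop at $i$ is counted once in $m_{ii}$). For $z\in\mathbb N_0^p$, $\mathrm{supp}(z)$ is the full subquiver of $Q$ with vertex set $\{i\mid z_i\neq 0\}$. $e_i\in\mathbb N_0^p$ is the vector with $1$ in position $i$ and $0$ elsewhere. Inequalities between vectors are componentwise: $(t_1,\dots,t_p)\ge(z_1,\dots,z_p)$ means $t_1\ge z_1,\dots,t_p\ge z_p$. The symbol $\bullet$ denotes the quiver with one vertex and no arrows, $\bullet\to\bullet$ the quiver with two vertices and exactly one arrow, joining them. $D(Q)$ is the subset of $\mathbb N_0^p$ consisting of $e_1,\dots,e_p$, all $e_i+e_j$ with $m_{ij}=1$, and all nonzero $z$ such that $\mathrm{supp}(z)$ is connected, $\mathrm{supp}(z)\notin\{\bullet,\ \bullet\to\bullet\}$ (up to isomorphism of quivers), and $zM_Q\ge z$. *)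

(* Defs.v *)
From HB Require Import structures.
From mathcomp Require Import all_boot all_order all_algebra.
From mathcomp Require Import reals.
From mathcomp Require Import complex.

Set Implicit Arguments.
Unset Strict Implicit.
Unset Printing Implicit Defensive.

Import GRing.Theory Num.Theory.
Local Open Scope ring_scope.

Record quiver := Quiver {
  vertex : finType;
  arrow : finType;
  source : arrow -> vertex;
  target : arrow -> vertex
}.

Definition quiver_iso (Q Q' : quiver) : Prop :=
  exists (f : vertex Q -> vertex Q') (g : arrow Q -> arrow Q'),
    [/\ bijective f, bijective g,
        forall a, source (g a) = f (source a)
      & forall a, target (g a) = f (target a)].

Definition one_vertex : quiver :=
  @Quiver unit void (@of_void unit) (@of_void unit).

Definition one_arrow : quiver :=
  @Quiver bool unit (fun=> false) (fun=> true).

(* A loop [i -> i] satisfies both disjuncts but is one element of the set, so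
   it is counted once in the diagonal entry. *)
Definition arrows_between (Q : quiver) (i j : vertex Q) : nat :=
  #|[set a : arrow Q | (source a == i) && (target a == j)
                    || (source a == j) && (target a == i)]|.

(* Connectedness of the underlying undirected graph; the quiver without
   vertices also satisfies it. *)
Definition connected (Q : quiver) : Prop :=
  forall i j : vertex Q,
    connect [rel x y | (0 < arrows_between x y)%N] i j.

Definition full_subquiver (Q : quiver) (P : pred (vertex Q)) : quiver :=
  @Quiver {i : vertex Q | P i} {a : arrow Q | P (source a) && P (target a)}
    (fun a => exist _ (source (val a)) (proj1 (andP (valP a))))
    (fun a => exist _ (target (val a)) (proj2 (andP (valP a)))).

Definition supp (Q : quiver) (z : vertex Q -> nat) : quiver :=
  full_subquiver (fun i => z i != 0%N).

Definition unit_vector (Q : quiver) (i : vertex Q) : vertex Q -> nat :=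
  fun j => (j == i : nat).

Definition D (Q : quiver) (z : vertex Q -> nat) : Prop :=
  [\/ exists i, z =1 unit_vector i,
      exists i j, arrows_between i j = 1%N
                  /\ z =1 (fun k => unit_vector i k + unit_vector j k)%N
    | [/\ exists i, z i != 0%N,
          connected (supp z),
          ~ quiver_iso (supp z) one_vertex,
          ~ quiver_iso (supp z) one_arrow
        & forall j, (z j <= \sum_i z i * arrows_between i j)%N]].

(* Complex numbers are [R[i]] for a real number type [R]. *)
Definition urep (R : realType) (Q : quiver) (d : vertex Q -> nat) : Type :=
  forall a : arrow Q, 'M[R[i]]_(d (target a), d (source a)).

(* Only representations of pointwise equal dimensions are isometric. Keeping
   two names for the dimension avoids casts: under [d =1 d'] the matrices
   [S i] are square, and [unitarymx] means unitary in the usual sense. *)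
Definition isometric (R : realType) (Q : quiver) (d d' : vertex Q -> nat)
    (A : urep R d) (B : urep R d') : Prop :=
  d =1 d' /\
  exists S : forall i : vertex Q, 'M[R[i]]_(d' i, d i),
    (forall i, S i \is unitarymx) /\
    (forall a, S (target a) *m A a = B a *m S (source a)).

Definition dsum (R : realType) (Q : quiver) (d1 d2 : vertex Q -> nat)
    (A : urep R d1) (B : urep R d2) : urep R (fun i => d1 i + d2 i)%N :=
  fun a => block_mx (A a) 0 0 (B a).

Definition indecomposable (R : realType) (Q : quiver) (d : vertex Q -> nat)
    (A : urep R d) : Prop :=
  ~ (forall i, d i = 0%N) /\
  forall (d1 d2 : vertex Q -> nat) (B : urep R d1) (C : urep R d2),
    isometric A (dsum B C) ->
    (forall i, d1 i = 0%N) \/ (forall i, d2 i = 0%N).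

(* Main.v *)
Require Import Defs.
From mathcomp Require Import all_boot all_order all_algebra.
From mathcomp Require Import reals.
From mathcomp Require Import complex.
From mathcomp Require Import boolp zify.

(* Necessity: subspaces M_i with A M_s in M_t and A^* M_t in M_s split A off
   together with their orthogonal complements. Applied to a connected
   component, to the span of the images of all arrows and adjoint arrows at one
   vertex, and to the line of an eigenvector of A^* A (for a single arrow), this
   forces the conditions defining D(Q).

   Sufficiency: A is indecomposable as soon as its commutant is trivial. Such an
   A is built by raising one coordinate of the dimension at a time. If A has
   dimension w and trivial commutant and no joint kernel at a vertex j without
   loops, then the maps leaving j (arrows and adjoint arrows) embed V_j in the
   direct sum U of their targets. When w_j < dim U = (w M_Q)_j there is b in U
   orthogonal to the image; sending a new basis vector of V_j to b, scaled so
   that |b|^2 is not an eigenvalue of the Gram operator on the old V_j, gives a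
   representation of dimension w + e_j which again has trivial commutant. Start
   with dimension 1 at the vertices without loops and the full dimension at the
   others. If no coordinate j with w_j < z_j can be raised, then every such j
   has a neighbour i with w_i < z_i, and w_i = w_j, m_ij = 1 with no further
   neighbours, so that the support is a single arrow. *)

Set Implicit Arguments.
Unset Strict Implicit.
Unset Printing Implicit Defensive.

Import Order.TTheory GRing.Theory Num.Theory.
Local Open Scope ring_scope.
Local Open Scope sesquilinear_scope.

(** * Linear dependencies by counting ranks *)

(** If $(y_i)\mapsto\sum_i y_iA_i$ had no kernel on the direct sum of the row spaces of the [E i],
    each [A i] would preserve the rank of [E i] and the images would be independent, so the ranks
    would add up. *)
Lemma sums_dependency (F : fieldType) (I : finType) (P : pred I) n
    (E A : I -> 'M[F]_n) :
  (\rank (\sum_(i | P i) <<E i *m A i>>)%MS < \sum_(i | P i) \rank (E i))%N ->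
  exists y : I -> 'rV[F]_n,
    [/\ forall i, (y i <= E i)%MS, \sum_(i | P i) y i *m A i = 0
      & exists2 i, P i & y i != 0].
Proof.
move=> ltr; have [//|noy] := EM (exists y : I -> 'rV[F]_n,
    [/\ forall i, (y i <= E i)%MS, \sum_(i | P i) y i *m A i = 0
      & exists2 i, P i & y i != 0]).
have y0 (y : I -> 'rV[F]_n) : (forall i, (y i <= E i)%MS) ->
    \sum_(i | P i) y i *m A i = 0 -> forall i, P i -> y i = 0.
  move=> yE ys i Pi; have [//|yi] := eqVneq (y i) 0.
  by case: noy; exists y; split=> //; exists i.
have rkE i : P i -> \rank <<E i *m A i>> = \rank (E i).
  move=> Pi; rewrite genmxE; have := mxrank_mul_ker (E i) (A i).
  suff -> : (E i :&: kermx (A i))%MS = 0 by rewrite mxrank0 addn0.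
  apply/eqP/rowV0P => v; rewrite sub_capmx => /andP[vE /sub_kermxP vA].
  have := y0 (fun k => if k == i then v else 0) _ _ i Pi; rewrite eqxx.
  apply=> [k|]; first by case: eqP => [->|_] //; rewrite sub0mx.
  rewrite (bigD1 i) //= eqxx vA big1 ?addr0 // => k /andP[_ /negPf->].
  by rewrite mul0mx.
have dir : mxdirect (\sum_(i | P i) <<E i *m A i>>)%MS.
  apply/mxdirect_sumsP => i Pi; apply/eqP/rowV0P => v.
  rewrite sub_capmx genmxE => /andP[/submxP[a va] /sub_sumsmxP[u vu]].
  (* A vector [v] common to image [i] and the sum of the others has a preimage on either side;
     [pinvmx] recovers the second one, and the difference of the two is a dependency. *)
  pose y k := if k == i then a *m E i else
    - (u k *m (<<E k *m A k>>%MS *m pinvmx (E k *m A k)) *m E k).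
  suff yi : y i = 0 
    by rewrite va mulmxA; move: yi; rewrite /y eqxx => ->; rewrite mul0mx.
  apply: (y0 y) (Pi) => [k|].
    rewrite /y; case: eqP => [->|_]; first exact: submxMl.
    by rewrite eqmx_opp submxMl.
  have yiE : y i = a *m E i by rewrite /y eqxx.
  rewrite (bigD1 i) //= yiE -mulmxA -va {1}vu -big_split big1 //= => k.
  move=> /andP[_ /negPf ki]; rewrite /y ki mulNmx.
  rewrite -(mulmxA _ (E k)) -(mulmxA (u k)) mulmxKpV ?subrr //.
  by rewrite genmxE.
by move: ltr; rewrite (mxdirectP dir) /= (eq_bigr _ rkE) ltnn.
Qed.

(** * Adjoint matrices *)

Section Adjoint.
Variable C : numClosedFieldType.

Lemma adjmxM m n p (A : 'M[C]_(m, n)) (B : 'M_(n, p)) :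
  (A *m B)^t* = B^t* *m A^t*.
Proof. by rewrite trmx_mul map_mxM. Qed.

Lemma adjmxD m n (A B : 'M[C]_(m, n)) : (A + B)^t* = A^t* + B^t*.
Proof. by rewrite linearD map_mxD. Qed.

Lemma adjmx0 m n : (0 : 'M[C]_(m, n))^t* = 0.
Proof. by rewrite trmx0 map_mx0. Qed.

Lemma adjmxZ m n a (A : 'M[C]_(m, n)) : (a *: A)^t* = a^* *: A^t*.
Proof. by rewrite linearZ map_mxZ. Qed.

Lemma adjmx_sum m n (I : finType) (P : pred I) (A : I -> 'M[C]_(m, n)) :
  (\sum_(i | P i) A i)^t* = \sum_(i | P i) (A i)^t*.
Proof. by rewrite linear_sum map_mx_sum. Qed.

Lemma adjmx_pid m n r : (pid_mx r : 'M[C]_(m, n))^t* = pid_mx r.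
Proof. by rewrite tr_pid_mx map_pid_mx. Qed.

Lemma pid_mxK n r : (pid_mx r : 'M[C]_n) *m (pid_mx r : 'M[C]_n) = pid_mx r.
Proof. by rewrite mul_pid_mx minnn pid_mx_minv. Qed.

Lemma gram_scalar m (v : 'cV[C]_m) :
  exists2 a : C, v^t* *m v = a%:M & 0 <= a ?= iff (v == 0).
Proof.
exists ((v^t* *m v) 0 0); first exact: mx11_scalar.
have E : (v^t* *m v) 0 0 = \sum_i `|v i 0| ^+ 2.
  by rewrite mxE; apply: eq_bigr => i _; rewrite !mxE normCKC.
rewrite E; split; first by apply: sumr_ge0 => i _; rewrite exprn_ge0.
rewrite eq_sym psumr_eq0 => [|i _]; last by rewrite exprn_ge0.
apply/idP/eqP => [/allP v0|->]; last first.
  by apply/allP => i _; rewrite mxE normr0 expr0n eqxx.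
apply/colP => i; rewrite mxE; apply/eqP; move: (v0 i (mem_index_enum _)).
by rewrite expf_eq0 normr_eq0.
Qed.

(** The numbers $c^2b$ with $1\le c\le$ [size p] are distinct and outnumber the roots of [p].
    Squares occur because scaling a vector by $c$ multiplies its squared norm by $c^2$. *)
Lemma exists_square_not_root (p : {poly C}) (b : C) : p != 0 -> b != 0 ->
  exists2 c : nat, (0 < c)%N & ~~ root p (c%:R ^+ 2 * b).
Proof.
move=> p0 b0; have [//|no] := EM (exists2 c : nat, (0 < c)%N & ~~ root p (c%:R ^+ 2 * b)).
have := @max_poly_roots _ p [seq (i%:R ^+ 2 * b) | i <- iota 1 (size p)] p0.
rewrite size_map size_iota ltnn => absurd; suff: false by []; apply: absurd.
  apply/allP => _ /mapP[i + ->]; rewrite mem_iota => /andP[i0 _].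
  by apply/negPn/negP => ri; apply: no; exists i.
rewrite map_inj_uniq ?iota_uniq // => i k /(mulIf b0) /eqP.
by rewrite eqrXn2 ?ler0n // eqr_nat => /eqP.
Qed.

End Adjoint.

(** * Raising the dimension at one vertex *)

Section Extension.
Variables (C : numClosedFieldType) (V X : finType).
Variables (s : X -> V) (inv : X -> X) (N : nat).
Local Notation t x := (s (inv x)).

(* To avoid dependent matrix sizes, V_i is the span of the first w i standard
   vectors of a common C^N, and [pid_mx (w i)] is the projection onto it. The
   index x runs over arrows and reversed arrows, [inv] reverses them, and
   [B (inv x)] is the adjoint of [B x]. *)
Definition padded_rep (w : V -> nat) (B : X -> 'M[C]_N) :=
  (forall x, B (inv x) = (B x)^t*) /\
  (forall x, B x *m pid_mx (w (s x)) = B x).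

(** As [x] includes reversed arrows, this is the commutant of a self-adjoint family; its orthogonal
    projections correspond to orthogonal decompositions. *)
Definition scalar_commutant (w : V -> nat) (B : X -> 'M[C]_N) :=
  forall H : V -> 'M[C]_N,
    (forall i, pid_mx (w i) *m H i *m pid_mx (w i) = H i) ->
    (forall x, H (t x) *m B x = B x *m H (s x)) ->
    exists a, forall i, H i = a *: pid_mx (w i).

Definition no_joint_kernel (w : V -> nat) (B : X -> 'M[C]_N) (i : V) :=
  forall v : 'cV[C]_N, pid_mx (w i) *m v = v ->
    (forall x, s x = i -> B x *m v = 0) -> v = 0.

(** The family [b] is a nonzero vector of $U$ orthogonal to the image of $V_j$, obtained as the
    adjoint of a dependency between rows; [beta] is its squared norm. *)
Lemma coupling_vectors (w : V -> nat) (B : X -> 'M[C]_N) (j : V) :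
  padded_rep w B ->
  (w j < \sum_(x | s x == j) minn N (w (t x)))%N ->
  exists (b : X -> 'cV[C]_N) (beta : C),
    [/\ [/\ forall x, s x != j -> b x = 0,
         forall x, pid_mx (w (t x)) *m b x = b x
       & exists x, b x != 0],
       \sum_(x | s x == j) (B x)^t* *m b x = 0,
       \sum_(x | s x == j) (b x)^t* *m b x = beta%:M,
       beta != 0
     & forall y : 'rV[C]_N,
         y *m (\sum_(x | s x == j) (B x)^t* *m B x) = beta *: y -> y = 0].
Proof.
move=> [_ BE] ltw.
have [|y [yE yB [x0 x0j yx0]]] := @sums_dependency C X (fun x => s x == j) N
    (fun x => pid_mx (w (t x))) B.
  apply: leq_ltn_trans (leq_trans ltw _); last first.
    apply: leq_sum => x _; rewrite -pid_mx_minv rank_pid_mx ?geq_minl //.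
  have: (\sum_(x | s x == j) <<(pid_mx (w (t x)) : 'M[C]_N) *m B x>>
      <= (pid_mx (w j) : 'M[C]_N))%MS.
    apply/sumsmx_subP => x /eqP xj; rewrite genmxE -BE xj mulmxA.
    exact: submxMl.
  move/mxrankS/leq_trans; apply.
  by rewrite -pid_mx_minv rank_pid_mx ?geq_minl ?geq_minr.
set G := \sum_(x | s x == j) (B x)^t* *m B x.
pose b0 x := if s x == j then (y x)^t* else 0.
have [beta0 bb0 beta0_neq0] :
  exists2 a : C, \sum_(x | s x == j) (b0 x)^t* *m b0 x = a%:M & a != 0.
  pose g x := s2val (cid2 (gram_scalar (b0 x))).
  have gE x : (b0 x)^t* *m b0 x = (g x)%:M by rewrite /g; case: cid2.
  have g0 x : 0 <= g x ?= iff (b0 x == 0) by rewrite /g; case: cid2.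
  exists (\sum_(x | s x == j) g x).
    by rewrite raddf_sum; apply: eq_bigr => x _; rewrite gE.
  rewrite psumr_eq0 => [|x _]; last by rewrite (g0 x).
  apply/allPn; exists x0; rewrite ?mem_index_enum // x0j /= eq_sym (g0 x0).
  rewrite /b0 x0j; apply: contraNneq yx0 => y0.
  by rewrite -[y x0]trmxCK y0 adjmx0.
have pG : char_poly G != 0 by exact: monic_neq0 (char_poly_monic G).
(* Rescaling by [c] moves the squared norm off the spectrum of [G]. *)
have [c c0 cr] := exists_square_not_root pG beta0_neq0.
have cC : (c%:R : C)^* = c%:R by exact: conjC_nat.
have cN0 : c%:R != 0 :> C by rewrite pnatr_eq0 -lt0n.
exists (fun x => c%:R *: b0 x), (c%:R ^+ 2 * beta0); split.
- split=> [x /negPf xj|x|].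
  + by rewrite /b0 xj scaler0.
  + rewrite -scalemxAr; congr (_ *: _); rewrite /b0; case: ifP => _.
      rewrite -[pid_mx _](@adjmx_pid C) -adjmxM; congr (_^t*).
      by case/submxP: (yE x) => a ->; rewrite -mulmxA pid_mxK.
    by rewrite mulmx0.
  + exists x0; rewrite scaler_eq0 negb_or cN0 /b0 x0j.
    apply: contraNneq yx0 => y0.
    by rewrite -[y x0]trmxCK y0 adjmx0.
- have -> : \sum_(x | s x == j) (B x)^t* *m (c%:R *: b0 x) =
      c%:R *: (\sum_(x | s x == j) y x *m B x)^t*.
    rewrite adjmx_sum scaler_sumr; apply: eq_bigr => x xj.
    by rewrite /b0 xj adjmxM -scalemxAr.
  by rewrite yB adjmx0 scaler0.
- rewrite -scale_scalar_mx -bb0 scaler_sumr; apply: eq_bigr => x _.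
  by rewrite adjmxZ cC -scalemxAl -scalemxAr scalerA -expr2.
- by rewrite mulf_neq0 // expf_neq0.
- move=> v vG; apply/eqP; apply: contraNT cr => v0.
  by rewrite -eigenvalue_root_char; apply/eigenvalueP; exists v.
Qed.

Hypothesis invK : involutive inv.

(** On the old $V_j$ plus the new line the Gram operator is $G\oplus\beta$, with $\beta$ not an
    eigenvalue of $G$, so every [H] in the commutant is block diagonal at [j]. The old part of [H]
    is scalar by assumption, and [b] ties the new entry to that scalar. *)
Lemma extend_rep (P : pred V) (w : V -> nat) (B : X -> 'M[C]_N) (j : V) :
  (forall x, s x = j -> t x != j) -> (w j < N)%N ->
  (w j < \sum_(x | s x == j) minn N (w (t x)))%N -> P j ->
  padded_rep w B -> scalar_commutant w B ->
  (forall i, P i -> no_joint_kernel w B i) ->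
  let w' i := (w i + (i == j))%N in
  exists B' : X -> 'M[C]_N,
    [/\ padded_rep w' B', scalar_commutant w' B'
      & forall i, P i -> no_joint_kernel w' B' i].
Proof.
move=> noloop wN wlt Pj Brep Bscal Bker w'.
have [b [beta [[b0 bE [x0 bx0]] Bb bb beta0 nev]]] := coupling_vectors Brep wlt.
case: (Brep) => Binv BEs.
pose E i : 'M[C]_N := pid_mx (w i).
pose E' i : 'M[C]_N := pid_mx (w' i).
(* Coordinates count from 0, so this is the first standard vector outside $V_j$. *)
pose u : 'cV[C]_N := delta_mx (Ordinal wN) 0.
pose ua : 'rV[C]_N := u^t*.
have EE i : E i *m E i = E i by exact: pid_mxK.
have Ea i : (E i)^t* = E i by exact: adjmx_pid.
have uau : ua *m u = 1%:M.
  apply/matrixP=> i k; rewrite !ord1 !mxE (bigD1 (Ordinal wN)) //= !mxE !eqxx /=.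
  rewrite conjC1 mulr1 big1 ?addr0 // => l /negPf lj; rewrite !mxE lj /=.
  by rewrite mulr0.
have Eju : E j *m u = 0.
  apply/matrixP=> i k; rewrite !mxE big1 // => l _; rewrite !mxE.
  have [->|lj] := eqVneq l (Ordinal wN); last by rewrite mulr0.
  have [->|_] /= := eqVneq i (Ordinal wN); first by rewrite eqxx ltnn mul0r.
  by case: eqP => [il|_]; rewrite ?il ?ltnn ?mul0r.
have uaEj : ua *m E j = 0 by rewrite -[E j]Ea -adjmxM Eju adjmx0.
have E'j : E' j = E j + u *m ua.
  apply/matrixP => i k; rewrite /E' /w' eqxx addn1 !mxE big_ord1 !mxE /=.
  rewrite -!val_eqE /= !eqxx !andbT conjC_nat -natrM -natrD.
  congr (_%:R); have [->|ik] := eqVneq (i : nat) k; first by rewrite ltnS; case: ltngtP.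
  by case: eqP => // iw; case: eqP => // kw; rewrite iw kw eqxx in ik.
have E'i i : i != j -> E' i = E i.
  by move=> /negPf ij; rewrite /E' /w' ij addn0.
have bx0j x : b x != 0 -> s x = j /\ t x != j.
  move=> bx; have sx : s x = j by apply/eqP; apply: contraNT bx => /b0 ->.
  by split=> //; apply: noloop.
have Eub x : E (s x) *m u *m (b x)^t* = 0.
  have [->|/bx0j [-> _]] := eqVneq (b x) 0; first by rewrite adjmx0 mulmx0.
  by rewrite Eju mul0mx.
have buE x : b x *m ua *m E (s x) = 0.
  have [->|/bx0j [-> _]] := eqVneq (b x) 0; first by rewrite !mul0mx.
  by rewrite -mulmxA uaEj mulmx0.
have baE x : (b x)^t* *m E (t x) = (b x)^t* by rewrite -[E _]Ea -adjmxM bE.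
(* The last term is the adjoint of the middle one for [inv x]. Since [j] has no loop, at most one of
   the two is nonzero. *)
pose B' x := B x + b x *m ua + u *m (b (inv x))^t*.
have B'inv x : B' (inv x) = (B' x)^t*.
  by rewrite /B' !adjmxD !adjmxM !trmxCK Binv invK addrAC.
have EBt x : E (t x) *m B x = B x.
  by rewrite -[B x]trmxCK -[E _]Ea -adjmxM -Binv BEs.
have B'E x : B' x *m E (s x) = B x + u *m (b (inv x))^t*.
  rewrite /B' !mulmxDl buE BEs addr0; congr (_ + _).
  by rewrite -mulmxA; have := baE (inv x); rewrite invK => ->.

have EB' x : E (t x) *m B' x = B x + b x *m ua.
  have := B'E (inv x); rewrite B'inv invK => /(congr1 (fun M => M^t*)).
  by rewrite adjmxM trmxCK Ea adjmxD adjmxM !trmxCK Binv trmxCK.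
have B'at x : s x = j -> B' x = B x + b x *m ua.
  move=> xj; rewrite /B' (b0 (inv x)) ?adjmx0 ?mulmx0 ?addr0 //.
  exact: noloop.
have Bu x : s x = j -> B x *m u = 0.
  by move=> xj; rewrite -BEs xj -mulmxA Eju mulmx0.
have B'u x : s x = j -> B' x *m u = b x.
  by move=> xj; rewrite B'at // mulmxDl Bu // add0r -mulmxA uau mulmx1.
set G := \sum_(x | s x == j) (B x)^t* *m B x in nev.
have GE : G *m E j = G.
  rewrite mulmx_suml; apply: eq_bigr => x /eqP xj.
  by rewrite -mulmxA -[in E j]xj BEs.
have Ga : G^t* = G.
  by rewrite adjmx_sum; apply: eq_bigr => x _; rewrite adjmxM trmxCK.
have EG : E j *m G = G by rewrite -{1}Ga -[E j]Ea -adjmxM GE Ga.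
pose G' := \sum_(x | s x == j) (B' x)^t* *m B' x.
have betaa : beta^* = beta.
  have : (beta%:M : 'M[C]_1)^t* = beta%:M.
    by rewrite -bb adjmx_sum; apply: eq_bigr => x _; rewrite adjmxM trmxCK.
  by move/matrixP/(_ 0 0); rewrite !mxE eqxx.
(* The cross terms vanish by [Bb]. *)
have G'E : G' = G + beta *: (u *m ua).
  have -> : beta *: (u *m ua) = (\sum_(x | s x == j) (B x)^t* *m b x) *m ua
      + u *m (\sum_(x | s x == j) (B x)^t* *m b x)^t*
      + u *m (\sum_(x | s x == j) (b x)^t* *m b x) *m ua.
    by rewrite Bb bb adjmx0 mul0mx mulmx0 !add0r mul_mx_scalar scalemxAl.
  rewrite adjmx_sum !mulmx_suml !mulmx_sumr mulmx_suml -!big_split.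
  apply: eq_bigr => x /eqP xj.
  rewrite /= B'at // adjmxD adjmxM trmxCK mulmxDl !mulmxDr adjmxM trmxCK !mulmxA.
  by rewrite -!addrA; congr (_ + _); rewrite !addrA.
have Gu : G *m u = 0 by rewrite -GE -mulmxA Eju mulmx0.
have uaG : ua *m G = 0 by rewrite -EG mulmxA uaEj mul0mx.
have G'u : G' *m u = beta *: u.
  by rewrite G'E mulmxDl Gu add0r -scalemxAl -mulmxA uau mulmx1.
have uaG' : ua *m G' = beta *: ua.
  by rewrite G'E mulmxDr uaG add0r -scalemxAr mulmxA uau mul1mx.
exists B'; split.
- split=> // x; rewrite -/(E' (s x)).
  have [xj|xj] := eqVneq (s x) j.
    rewrite B'at // xj E'j mulmxDr !mulmxDl -!mulmxA.
    rewrite -/(E j) -[in E j]xj BEs xj uaEj mulmx0 addr0 mulmxA Bu // mul0mx add0r.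
    by rewrite [ua *m _]mulmxA uau mul1mx.
  by rewrite E'i // B'E /B' (b0 x) // mul0mx addr0.
- move=> H HE Hc.
  have HG : H j *m G' = G' *m H j.
    rewrite mulmx_sumr mulmx_suml; apply: eq_bigr => x /eqP xj.
    rewrite -B'inv -mulmxA -[in RHS]xj -Hc !mulmxA; congr (_ *m _).
    by have := Hc (inv x); rewrite invK xj.
  have HjG : H j *m G = G' *m H j - beta *: (H j *m u *m ua).
    by rewrite -HG G'E mulmxDr -scalemxAr mulmxA addrK.
  have GHj : G *m H j = H j *m G' - beta *: (u *m ua *m H j).
    by rewrite HG G'E mulmxDl -scalemxAl addrK.
  (* This off-diagonal block of [H j] satisfies the eigenvector equation of [G] for [beta], so [nev]
     kills it. *)
  have uHE : ua *m H j *m E j = 0.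
    have uHG : ua *m H j *m G = beta *: (ua *m H j) - beta *: (ua *m H j *m u *m ua).
      by rewrite -mulmxA HjG mulmxBr !mulmxA uaG' -scalemxAl -scalemxAr !mulmxA.
    apply: nev; rewrite -/G -mulmxA EG -{1}GE mulmxA uHG mulmxBl -!scalemxAl.
    by rewrite -(mulmxA _ ua) uaEj mulmx0 scaler0 subr0.
  (* For the other block the adjoint is taken first: [G] is self-adjoint and [beta] is real, so the
     column becomes a row to which [nev] applies. *)
  have EHu : E j *m H j *m u = 0.
    have GHu : G *m H j *m u = beta *: (H j *m u) - beta *: (u *m (ua *m H j *m u)).
      by rewrite GHj mulmxBl -(mulmxA (H j)) G'u -scalemxAr -scalemxAl !mulmxA.
    have K : G *m (E j *m H j *m u) = beta *: (E j *m H j *m u).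
      rewrite !mulmxA GE -{1}EG -!(mulmxA (E j)) GHu mulmxBr -!scalemxAr.
      by rewrite !mulmxA Eju !mul0mx scaler0 subr0.
    have /nev K' : (E j *m H j *m u)^t* *m G = beta *: (E j *m H j *m u)^t*.
      by rewrite -{1}Ga -adjmxM K adjmxZ betaa.
    by rewrite -[LHS]trmxCK K' adjmx0.
  have EHub x : E (s x) *m H (s x) *m u *m (b x)^t* = 0.
    have [->|/bx0j [-> _]] := eqVneq (b x) 0; first by rewrite adjmx0 mulmx0.
    by rewrite EHu mul0mx.
  have buHE x : b x *m (ua *m H (s x) *m E (s x)) = 0.
    have [->|/bx0j [-> _]] := eqVneq (b x) 0; first by rewrite !mul0mx.
    by rewrite uHE mulmx0.
  have HE' i : E' i *m H i *m E' i = H i := HE i.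
  (* Without off-diagonal blocks, the compressions of [H] to the old spaces commute with the old
     [B]. *)
  have [i||a aH] := Bscal (fun i => E i *m H i *m E i).
  - by rewrite !mulmxA -/(E i) EE -!mulmxA EE.
  - move=> x; rewrite -mulmxA EBt !mulmxA BEs.
    have := congr1 (fun M => E (t x) *m M *m E (s x)) (Hc x).
    have := EHub (inv x); have := buHE x.
    rewrite -!mulmxA B'E !mulmxA EB' !mulmxDl !mulmxDr !mulmxA => -> ->.
    by rewrite !addr0.
  have [h hE] : exists h, ua *m H j *m u = h%:M.
    by exists ((ua *m H j *m u) 0 0); exact: mx11_scalar.
  have Hju : H j *m u = h *: u.
    have E'u : E' j *m u = u by rewrite E'j mulmxDl Eju add0r -mulmxA uau mulmx1.
    rewrite -HE' -!mulmxA E'u E'j mulmxDl mulmxA EHu add0r -mulmxA.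
    by rewrite (mulmxA ua) hE mul_mx_scalar.
  (* [B' x0] carries [u] to the nonzero vector [b x0], on which [H] acts both by [a] and by [h]. *)
  have ah : a = h.
    have [x0j tx0] := bx0j _ bx0.
    have := congr1 (fun M => M *m u) (Hc x0); rewrite /= -!mulmxA B'u // x0j Hju.
    rewrite -scalemxAr B'u // -HE' E'i // aH -scalemxAl bE => /eqP.
    by rewrite -subr_eq0 -scalerBl scaler_eq0 (negPf bx0) orbF subr_eq0 => /eqP.
  exists a => i; rewrite -/(E' i) -HE'; have [->|ij] := eqVneq i j; last first.
    by rewrite E'i // aH.
  rewrite E'j !mulmxDl !mulmxDr aH (mulmxA _ u ua) EHu mul0mx addr0.
  rewrite -!(mulmxA u) uHE mulmx0 add0r (mulmxA _ u ua) hE.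
  by rewrite mul_scalar_mx -scalemxAr -ah scalerDr.
- move=> i Pi v; rewrite -/(E' i) => vE vB.
  have [ij|ij] := eqVneq i j; last first.
    apply: (Bker i) => // [|x xi]; first by rewrite -/(E i) -E'i.
    by have := EB' x; rewrite b0 ?xi // mul0mx addr0 => <-; rewrite -mulmxA vB // mulmx0.
  subst i.
  (* [G'] kills [v], while [ua] is a left eigenvector of [G'] for the nonzero [beta]; hence [v] lies
     in the old $V_j$. *)
  have uav : ua *m v = 0.
    have : beta *: (ua *m v) = 0.
      rewrite scalemxAl -uaG' -mulmxA mulmx_suml big1 ?mulmx0 // => x /eqP xj.
      by rewrite -mulmxA vB // mulmx0.
    by move/eqP; rewrite scaler_eq0 (negPf beta0) => /eqP.
  apply: (Bker j) => // [|x xj].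
    by rewrite -/(E j) -{2}vE E'j mulmxDl -mulmxA uav mulmx0 addr0.
  by have := vB x xj; rewrite B'at // mulmxDl -mulmxA uav mulmx0 addr0.
Qed.
End Extension.

(** * A representation of dimension one at the vertices without loops *)

Section Darts.
Variable Q : quiver.

(* The boolean [true] marks the reversed arrow. *)
Definition dart : Type := (arrow Q * bool)%type.

Definition dart_source (x : dart) : vertex Q :=
  if x.2 then target x.1 else source x.1.

Definition dart_inv (x : dart) : dart := (x.1, ~~ x.2).

Lemma dart_invK : involutive dart_inv.
Proof. by case=> a e; rewrite /dart_inv negbK. Qed.

Definition looped (i : vertex Q) : bool :=
  [exists a : arrow Q, (source a == i) && (target a == i)].

Definition supp_adj (w : vertex Q -> nat) : rel (vertex Q) :=
  [rel i j | [&& w i != 0, w j != 0 & 0 < arrows_between i j]%N].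

Definition supp_connected (w : vertex Q -> nat) : Prop :=
  forall i j, w i != 0%N -> w j != 0%N -> connect (supp_adj w) i j.

Lemma looped_dart x : dart_source (dart_inv x) = dart_source x ->
  looped (dart_source x).
Proof.
case: x => a [] /= e; apply/existsP; exists a; move: e;
  by rewrite /dart_source /= => ->; rewrite eqxx.
Qed.

End Darts.

Section BaseRep.
Variables (C : numClosedFieldType) (Q : quiver) (n : nat) (w : vertex Q -> nat).
Local Notation E i := (pid_mx (w i) : 'M[C]_n.+1).

(* The real part of [loop_mx] has simple spectrum and the imaginary part has no
   zero entry, so only scalars commute with both. *)
Definition ramp_mx : 'M[C]_n.+1 := diag_mx (\row_k k%:R).

Definition loop_mx : 'M[C]_n.+1 := ramp_mx + 'i *: const_mx 1.

Lemma adj_ramp_mx : ramp_mx^t* = ramp_mx.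
Proof.
rewrite /ramp_mx tr_diag_mx map_diag_mx; congr diag_mx.
by apply/rowP => k; rewrite !mxE rmorph_nat.
Qed.

Lemma adj_loop_mx : loop_mx^t* = ramp_mx - 'i *: const_mx 1.
Proof.
rewrite adjmxD adj_ramp_mx adjmxZ conjCi scaleNr trmx_const map_const_mx.
by rewrite rmorph1.
Qed.

(** Between distinct vertices of the support, rank one is enough to compare the scalars of the
    commutant at both ends. *)
Definition base_arrow (a : arrow Q) : 'M[C]_n.+1 :=
  if source a == target a then
    E (source a) *m loop_mx *m E (source a)
  else if (w (source a) != 0%N) && (w (target a) != 0%N) then pid_mx 1
  else 0.

Definition base_dart (x : dart Q) : 'M[C]_n.+1 :=
  if x.2 then (base_arrow x.1)^t* else base_arrow x.1.

Lemma pid1M r : r != 0%N ->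
  (pid_mx 1 : 'M[C]_n.+1) *m (pid_mx r : 'M[C]_n.+1) = pid_mx 1.
Proof.
by move=> r0; rewrite mul_pid_mx; congr pid_mx; case: r r0 => // -[|r].
Qed.

Lemma base_padded :
  padded_rep (@dart_source Q) (@dart_inv Q) w base_dart.
Proof.
split=> [[a []]|[a []]]; rewrite /base_dart /dart_source //= ?trmxCK //.
  rewrite /base_arrow; case: eqP => [->|_].
    by rewrite !adjmxM !adjmx_pid -!mulmxA pid_mxK.
  case: ifP => [/andP[_ w0]|_]; last by rewrite adjmx0 mul0mx.
  by rewrite adjmx_pid pid1M.
rewrite /base_arrow; case: eqP => _; first by rewrite -!mulmxA pid_mxK.
by case: ifP => [/andP[w0 _]|_]; rewrite ?mul0mx // pid1M.
Qed.

Lemma base_edge x : dart_source x != dart_source (dart_inv x) ->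
  w (dart_source x) != 0%N -> w (dart_source (dart_inv x)) != 0%N ->
  base_dart x = pid_mx 1.
Proof.
case: x => a []; rewrite /dart_source /base_dart /base_arrow /= => ne w1 w2.
  by rewrite eq_sym (negPf ne) w1 w2 adjmx_pid.
by rewrite (negPf ne) w1 w2.
Qed.

Lemma mulmx_pidr m (M : 'M[C]_(m, n.+1)) r k (l : 'I_n.+1) :
  (M *m (pid_mx r : 'M_n.+1)) k l = M k l *+ (l < r)%N.
Proof.
rewrite mxE (bigD1 l) //= mxE eqxx big1 ?addr0 /= => [|i /negPf il].
  by rewrite mulr_natr.
by rewrite mxE [_ == _ :> nat]il mulr0.
Qed.

Lemma mulmx_pidl m (M : 'M[C]_(n.+1, m)) r (k : 'I_n.+1) l :
  ((pid_mx r : 'M_n.+1) *m M) k l = M k l *+ (k < r)%N.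
Proof.
rewrite mxE (bigD1 k) //= mxE eqxx big1 ?addr0 /= => [|i /negPf il].
  by rewrite mulr_natl.
by rewrite mxE [_ == _ :> nat]eq_sym [_ == _ :> nat]il mul0r.
Qed.

(** [H] commutes with the compressed real and imaginary parts of [loop_mx]: the first makes it
    diagonal, the second makes its diagonal constant. *)
Lemma loop_commutant r (H : 'M[C]_n.+1) :
  let L := pid_mx r *m loop_mx *m pid_mx r in
  pid_mx r *m H *m pid_mx r = H ->
  H *m L = L *m H -> H *m L^t* = L^t* *m H -> H = H 0 0 *: pid_mx r.
Proof.
move=> L HE HL HLa.
set P : 'M[C]_n.+1 := pid_mx r in L HE HL HLa *.
have PP : P *m P = P by exact: pid_mxK.
have PH : P *m H = H by rewrite -HE !mulmxA PP.
have HP : H *m P = H by rewrite -HE -!mulmxA PP.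
have LE : L = P *m ramp_mx *m P + 'i *: (P *m const_mx 1 *m P).
  by rewrite /L mulmxDr mulmxDl -scalemxAr -scalemxAl.
have LaE : L^t* = P *m ramp_mx *m P - 'i *: (P *m const_mx 1 *m P).
  rewrite /L !adjmxM adj_loop_mx adjmx_pid -/P mulmxA mulmxBr mulmxBl.
  by rewrite -scalemxAr -scalemxAl.
have comm (M : 'M[C]_n.+1) c : c != 0 -> H *m (c *: M) = (c *: M) *m H -> H *m M = M *m H.
  move=> c0 /(congr1 (fun K => c^-1 *: K)).
  by rewrite scalemxAr scalemxAl !scalerA mulVf // !scale1r.
have HD : H *m (P *m ramp_mx *m P) = P *m ramp_mx *m P *m H.
  apply: (comm _ (2 : C)); first by rewrite pnatr_eq0.
  have -> : (2 : C) *: (P *m ramp_mx *m P) = L + L^t*.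
    by rewrite LaE LE scaler_nat mulr2n addrACA subrr addr0.
  by rewrite mulmxDl mulmxDr HL HLa.
have HJ : H *m (P *m const_mx 1 *m P) = P *m const_mx 1 *m P *m H.
  apply: (comm _ (2 * 'i : C)); first by rewrite mulf_neq0 ?pnatr_eq0 ?neq0Ci.
  have -> : (2 * 'i : C) *: (P *m const_mx 1 *m P) = L - L^t*.
    by rewrite LaE LE -scalerA scaler_nat mulr2n opprD opprK addrACA subrr add0r.
  by rewrite mulmxBl mulmxBr HL HLa.
have HD0 : H *m ramp_mx *m P = P *m (ramp_mx *m H).
  by move: HD; rewrite !mulmxA HP -!mulmxA PH.
have HJ0 : H *m const_mx 1 *m P = P *m (const_mx 1 *m H).
  by move: HJ; rewrite !mulmxA HP -!mulmxA PH.
have Hdiag k l : k != l -> H k l = 0.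
  move=> kl; have [lr|lr] := ltnP l r; last first.
    by rewrite -HP mulmx_pidr ltnNge lr.
  have [kr|kr] := ltnP k r; last by rewrite -PH mulmx_pidl ltnNge kr.
  move/matrixP: HD0 => /(_ k l); rewrite mulmx_pidl mulmx_pidr lr kr.
  rewrite mul_mx_diag mul_diag_mx !mxE mulrC => /eqP.
  rewrite -subr_eq0 -mulrBl mulf_eq0 subr_eq0 eqr_nat eq_sym.
  by rewrite [_ == _ :> nat](negPf kl) => /eqP.
have Hconst (k : 'I_n.+1) : (k < r)%N -> H k k = H 0 0.
  have HJr l : (H *m (const_mx 1 : 'M_n.+1)) k l = H k k.
    rewrite mxE (bigD1 k) //= big1 => [|i ik]; first by rewrite mxE mulr1 addr0.
    by rewrite Hdiag ?mul0r // eq_sym.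
  have HJl m l : ((const_mx 1 : 'M_n.+1) *m H) m l = H l l.
    rewrite mxE (bigD1 l) //= big1 => [|i il]; first by rewrite mxE mul1r addr0.
    by rewrite Hdiag ?mulr0.
  move=> kr; move/matrixP: HJ0 => /(_ k 0); rewrite mulmx_pidl mulmx_pidr kr.
  by rewrite (leq_trans _ kr) // HJr HJl.
apply/matrixP => k l; rewrite !mxE.
have [<-|kl] := eqVneq k l; last first.
  by rewrite Hdiag // [_ == _ :> nat](negPf kl) mulr0.
rewrite eqxx /=; have [kr|kr] := ltnP k r; first by rewrite Hconst ?mulr1.
by rewrite mulr0 -HP mulmx_pidr ltnNge kr.
Qed.

(** Each [H i] is scalar, by [loop_commutant] at a loop and by dimension elsewhere. Edges of the
    support equate these scalars. *)
Lemma base_scalar : supp_connected w ->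
  (forall i, ~~ looped i -> (w i <= 1)%N) ->
  scalar_commutant (@dart_source Q) (@dart_inv Q) w base_dart.
Proof.
move=> wconn wle H HE Hc.
have Hi i : H i = H i 0 0 *: E i.
  have [/existsP[a /andP[/eqP sa /eqP ta]]|nl] := boolP (looped i).
    apply: loop_commutant => //.
      by have := Hc (a, false); rewrite /base_dart /base_arrow /dart_source /= ta sa eqxx.
    by have := Hc (a, true); rewrite /base_dart /base_arrow /dart_source /= ta sa eqxx.
  rewrite -HE; have := wle _ nl; case: (w i) => [|[]] // _.
    by rewrite pid_mx_0 !mul0mx scaler0.
  apply/matrixP => k l; rewrite [RHS]mxE !mulmx_pidr !mulmx_pidl /=.
  rewrite [X in _ * X]mxE !ltnS !leqn0 mulr1n.
  have [->|k0] := eqVneq k 0; last first.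
    by rewrite (negPf (k0 : k != 0%N :> nat)) andbF mulr0 mulr0n mul0rn.
  have [->|l0] := eqVneq l 0; first by rewrite mulr1.
  have /negPf l0' : l != 0%N :> nat by [].
  by rewrite l0' [_ == nat_of_ord l]eq_sym l0' mulr0.
have step i j : supp_adj w i j -> H i 0 0 = H j 0 0.
  move=> /and3P[wi wj /card_gt0P[a]]; rewrite inE => adj.
  have edge x : i = dart_source x -> j = dart_source (dart_inv x) ->
      H i 0 0 = H j 0 0.
    move=> ix jx; have [->//|ij] := eqVneq i j.
    move/matrixP: (Hc x) => /(_ 0 0); rewrite -ix -jx base_edge -?ix -?jx //.
    by rewrite mulmx_pidr mulmx_pidl.
  case/orP: adj => /andP[/eqP sa /eqP ta].
    by apply: (edge (a, false)); rewrite /dart_source /= ?sa ?ta.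
  by apply: (edge (a, true)); rewrite /dart_source /= ?sa ?ta.
have conn i j : connect (supp_adj w) i j -> H i 0 0 = H j 0 0.
  case/connectP => p + ->; elim: p i => //= k p IH i /andP[/step -> /IH].
  by [].
have [/existsP[i0 wi0]|/existsPn w0] := boolP [exists i, w i != 0%N]; last first.
  exists 0 => i; rewrite Hi; have /negPn/eqP -> := w0 i.
  by rewrite pid_mx_0 !scaler0.
exists (H i0 0 0) => i; rewrite Hi.
have [->|wi] := eqVneq (w i) 0%N; first by rewrite pid_mx_0 !scaler0.
by rewrite (conn _ _ (wconn i0 i wi0 wi)).
Qed.

(** In dimension one the dart [x] alone already acts injectively. *)
Lemma base_no_kernel (x : dart Q) : ~~ looped (dart_source x) ->
  (w (dart_source x) <= 1)%N -> w (dart_source (dart_inv x)) != 0%N ->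
  no_joint_kernel (@dart_source Q) w base_dart (dart_source x).
Proof.
move=> nl w1 w2 v vE /(_ x erefl).
case w1E : (w (dart_source x)) w1 => [|[]] // _.
  by rewrite -vE w1E pid_mx_0 mul0mx.
rewrite base_edge ?w1E //; first by rewrite -{2}vE w1E => ->.
by apply: contraNneq nl => e; apply: looped_dart; rewrite -e.
Qed.

End BaseRep.

(** * Order of the increments *)

Section Dimensions.
Variable Q : quiver.
Implicit Types (z w : vertex Q -> nat) (i j k : vertex Q).

Lemma arrows_betweenC i j : arrows_between i j = arrows_between j i.
Proof. by apply: eq_card => a; rewrite !inE orbC. Qed.

Lemma loopedE i : looped i = (0 < arrows_between i i)%N.
Proof.
apply/existsP/card_gt0P => -[a]; rewrite ?inE ?orbb => aP; exists a => //.
by rewrite inE aP.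
Qed.

(** This is $\dim U=(wM_Q)_j$. A loop at [j] would give two darts but counts once in $M_Q$. *)
Lemma sum_darts w j : ~~ looped j ->
  (\sum_(x : dart Q | dart_source x == j) w (dart_source (dart_inv x)) =
   \sum_i w i * arrows_between i j)%N.
Proof.
move=> nl; transitivity (\sum_(a : arrow Q) (w (source a) * (target a == j)
                                      + w (target a) * (source a == j)))%N.
  rewrite big_mkcond /=.
  transitivity (\sum_a \sum_(b : bool) if dart_source (a, b) == j
    then w (dart_source (dart_inv (a, b))) else 0)%N.
    by rewrite pair_bigA; apply: eq_bigr => -[a b].
  apply: eq_bigr => a _; rewrite big_bool /dart_source /=.
  by do 2!case: eqP => _; rewrite ?muln1 ?muln0.
have abE i : arrows_between i j = (\sum_(a : arrow Q)
    ((source a == i) && (target a == j) || (source a == j) && (target a == i)))%N.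
  rewrite /arrows_between -sum1_card big_mkcond; apply: eq_bigr => a _.
  by rewrite inE; case: ifP.
under [RHS]eq_bigr => i _ do rewrite abE big_distrr /=.
rewrite exchange_big; apply: eq_bigr => a _ /=.
have [taj|taj] := eqVneq (target a) j.
  have saj : source a != j.
    by apply: contraNneq nl => saj; apply/existsP; exists a; rewrite saj taj eqxx.
  rewrite (negPf saj) muln1 muln0 addn0 (bigD1 (source a)) //= eqxx muln1.
  rewrite big1 ?addn0 // => i; rewrite eq_sym => /negPf -> /=; by rewrite muln0.
rewrite muln0 add0n; have [saj|saj] := eqVneq (source a) j; last first.
  by rewrite muln0 big1 // => i _; rewrite andbF /= muln0.
rewrite muln1 (bigD1 (target a)) //= eqxx orbT muln1.
rewrite big1 ?addn0 // => i; rewrite eq_sym => /negPf ->.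
by rewrite andbF muln0.
Qed.

Lemma supp_arrows_gt0 z (x y : vertex (supp z)) :
  (0 < arrows_between x y)%N = (0 < arrows_between (val x) (val y))%N.
Proof.
apply/card_gt0P/card_gt0P => -[a]; rewrite inE => aP.
  by exists (val a); move: aP; rewrite inE -!val_eqE.
have az : (z (source a) != 0%N) && (z (target a) != 0%N).
  by case/orP: aP => /andP[/eqP -> /eqP ->]; rewrite (valP x) (valP y).
by exists (exist _ a az); rewrite inE -!val_eqE.
Qed.

(** Trades paths in a subtype for paths in [Q] itself. *)
Lemma connected_supp z : connected (supp z) <-> supp_connected z.
Proof.
split=> [conn i j zi zj|conn x y].
  suff conn' (x y : vertex (supp z)) : connect (supp_adj z) (val x) (val y).
    exact: (conn' (exist _ i zi) (exist _ j zj)).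
  have /connectP[p + ->] := conn x y.
  elim: p x => [|k p IH] x //= /andP[xk /IH]; apply: connect_trans.
  apply: connect1; apply/and3P; split; [exact: (valP x)|exact: (valP k)|].
  by rewrite -supp_arrows_gt0.
have /connectP[p] := conn _ _ (valP x) (valP y).
elim: p x => [|k p IH] x /=.
  by move=> _ /val_inj ->.
case/andP=> /and3P[_ zk xk] kp yp.
have := IH (exist _ k zk) kp yp; apply: connect_trans; apply: connect1.
by rewrite /= supp_arrows_gt0.
Qed.

(** The arrow may run either way, so its own source and target, rather than [i] and [j], are matched
    with [false] and [true]. *)
Lemma supp_iso_one_arrow z i j : i != j -> z i != 0%N -> z j != 0%N ->
  ~~ looped i -> ~~ looped j -> arrows_between i j = 1%N ->
  (forall k, z k != 0%N -> k = i \/ k = j) ->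
  quiver_iso (supp z) one_arrow.
Proof.
move=> ij zi zj li lj /eqP /cards1P[a0 a0E] zij.
have a0P : (source a0 == i) && (target a0 == j) || (source a0 == j) && (target a0 == i).
  by have := set11 a0; rewrite -a0E inE.
have st : source a0 != target a0.
  by case/orP: a0P => /andP[/eqP -> /eqP ->] //; rewrite eq_sym.
have zs : z (source a0) != 0%N by case/orP: a0P => /andP[/eqP -> _].
have zt : z (target a0) != 0%N by case/orP: a0P => /andP[_ /eqP ->].
have vst k : z k != 0%N -> k = source a0 \/ k = target a0.
  case/zij => ->; case/orP: a0P => /andP[/eqP -> /eqP ->]; by [left | right].
have aa0 (a : arrow (supp z)) : val a = a0.
  apply/set1P; rewrite -a0E inE; have /andP[/zij as_ /zij at_] := valP a.
  case: as_ => sa; case: at_ => ta; rewrite sa ta ?eqxx ?orbT //.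
    by case/negP: li; apply/existsP; exists (val a); rewrite sa ta eqxx.
  by case/negP: lj; apply/existsP; exists (val a); rewrite sa ta eqxx.
pose vs : vertex (supp z) := exist _ (source a0) zs.
pose vt : vertex (supp z) := exist _ (target a0) zt.
exists (fun v => val v == target a0), (fun=> tt); split.
- apply: (@Bijective _ _ _ (fun b => if b then vt else vs)) => [v|[]] /=.
  + apply: val_inj; have [//|ne] := eqVneq (val v) (target a0).
    by case: (vst _ (valP v)) => // e; rewrite e eqxx in ne.
  + by rewrite eqxx.
  + exact: negPf.
- have a0z : (z (source a0) != 0%N) && (z (target a0) != 0%N) by rewrite zs zt.
  pose va : arrow (supp z) := exist _ a0 a0z.
  by apply: (@Bijective _ _ _ (fun=> va)) => [a|[]] //; apply: val_inj; rewrite aa0.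
- by move=> a /=; rewrite aa0 (negPf st).
- by move=> a /=; rewrite aa0 eqxx.
Qed.

(** If no vertex can be raised, two adjacent deficient vertices use up each other's bound
    $(wM_Q)_j\le w_j$ and leave no room for a third vertex of the support. *)
Lemma growth_step z w j0 : supp_connected z ->
  (forall j, z j <= \sum_i z i * arrows_between i j)%N ->
  ~ quiver_iso (supp z) one_arrow ->
  (forall i, w i <= z i)%N -> (forall i, z i != 0%N -> w i != 0%N) ->
  (forall i, looped i -> w i = z i) -> (w j0 < z j0)%N ->
  exists j, [/\ ~~ looped j, (w j < z j)%N
              & (w j < \sum_i w i * arrows_between i j)%N].
Proof.
move=> zconn zM niso wz supp_w wl wj0.
have [//|no] := EM (exists j, [/\ ~~ looped j, (w j < z j)%N
              & (w j < \sum_i w i * arrows_between i j)%N]).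
have nl j : (w j < z j)%N -> ~~ looped j.
  by move=> wj; apply: contraTN wj => /wl ->; rewrite ltnn.
have stuck j : (w j < z j)%N -> (\sum_i w i * arrows_between i j <= w j)%N.
  by move=> wj; rewrite leqNgt; apply/negP => lt; apply: no; exists j; split=> //; apply: nl.
(* Otherwise $z_j\le(zM_Q)_j\le(wM_Q)_j\le w_j$. *)
have nbr j : (w j < z j)%N -> exists2 i, (w i < z i)%N & (0 < arrows_between i j)%N.
  move=> wj; have [/existsP[i /andP[]]|/existsPn none] :=
    boolP [exists i, (w i < z i) && (0 < arrows_between i j)]%N; first by exists i.
  have: (z j <= w j)%N; last by rewrite leqNgt wj.
  apply: leq_trans (zM j) (leq_trans _ (stuck j wj)).
  apply: leq_sum => i _; have := none i; rewrite negb_and -!leqNgt leqn0.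
  by case/orP => [zw|/eqP ->]; rewrite ?muln0 // leq_mul2r zw orbT.
have term i j : (w j < z j)%N -> (w i * arrows_between i j <= w j)%N.
  move=> wj; apply: leq_trans (stuck j wj); by rewrite (bigD1 i) //= leq_addr.
have [i0 wi0 m0] := nbr j0 wj0.
have ij : i0 != j0.
  by apply: contraTneq m0 => ->; have := nl _ wj0; rewrite loopedE.
have pos i : (w i < z i)%N -> (0 < w i)%N.
  move=> wi; rewrite lt0n supp_w // -lt0n; exact: leq_ltn_trans wi.
have weq : w i0 = w j0.
  apply/eqP; rewrite eqn_leq (leq_trans _ (term i0 j0 wj0)) ?leq_pmulr //=.
  by rewrite (leq_trans _ (term j0 i0 wi0)) // arrows_betweenC leq_pmulr.
have m1 : arrows_between i0 j0 = 1%N.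
  apply/eqP; rewrite eqn_leq m0 andbT -(leq_pmul2l (pos _ wi0)) muln1.
  by rewrite (leq_trans (term _ _ wj0)) // weq.
(* The term of [i] alone fills the bound [w j]; another neighbour in the support would exceed it. *)
have only i j k : (w j < z j)%N -> (w i >= w j)%N -> (0 < arrows_between i j)%N ->
    z k != 0%N -> (0 < arrows_between k j)%N -> k = i.
  move=> wj wij mij zk mkj; apply/eqP/negPn/negP => ki.
  have := stuck j wj; rewrite (bigD1 i) //= (bigD1 k) //=.
  apply/negP; rewrite -ltnNge.
  have: (0 < w k * arrows_between k j)%N by rewrite muln_gt0 lt0n supp_w.
  have: (w j <= w i * arrows_between i j)%N by rewrite (leq_trans wij) ?leq_pmulr.
  move: (w k * _)%N (w i * _)%N => c b ; lia.
case: niso; apply: (@supp_iso_one_arrow z i0 j0) => //; try exact: nl.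
- by rewrite -lt0n (leq_ltn_trans _ wi0).
- by rewrite -lt0n (leq_ltn_trans _ wj0).
have zj0 : z j0 != 0%N by rewrite -lt0n (leq_ltn_trans _ wj0).
move=> k zk; have /connectP[p] := zconn j0 k zj0 zk.
(* The pair [i0], [j0] is closed under adjacency in the support. *)
suff cl p' i : i = i0 \/ i = j0 -> path (supp_adj z) i p' ->
    last i p' = i0 \/ last i p' = j0.
  by move=> pp ->; apply: cl pp; right.
elim: p' i => //= l p' IH i ii /andP[/and3P[_ zl mil] /IH]; apply.
case: ii mil => ->; rewrite arrows_betweenC => mil.
  by right; apply: (only j0 i0) => //; rewrite ?weq // arrows_betweenC.
by left; apply: (only i0 j0) => //; rewrite weq.
Qed.

End Dimensions.

(** * Sufficiency *)

Section Existence.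
Variables (C : numClosedFieldType) (Q : quiver) (n : nat).
Local Notation dsrc := (@dart_source Q).
Local Notation dinv := (@dart_inv Q).
Implicit Types z w : vertex Q -> nat.

(** Induction on the total deficit $\sum_i(z_i-w_i)$. The bound by [n] leaves room in the ambient
    space for each new vector. *)
Lemma grow_rep z w (B : dart Q -> 'M[C]_n.+1) :
  (forall i, z i <= n)%N -> supp_connected z ->
  (forall j, z j <= \sum_i z i * arrows_between i j)%N ->
  ~ quiver_iso (supp z) one_arrow ->
  (forall i, w i <= z i)%N -> (forall i, z i != 0%N -> w i != 0%N) ->
  (forall i, looped i -> w i = z i) ->
  padded_rep dsrc dinv w B -> scalar_commutant dsrc dinv w B ->
  (forall i, ~~ looped i -> no_joint_kernel dsrc w B i) ->
  exists B' : dart Q -> 'M[C]_n.+1,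
    padded_rep dsrc dinv z B' /\ scalar_commutant dsrc dinv z B'.
Proof.
move=> zn zconn zM niso; have [k] := ubnP (\sum_i (z i - w i))%N.
elim: k w B => // k IH w B; rewrite ltnS => wk wz zw wl Brep Bsc Bker.
have [/existsP[j0 wj0]|/existsPn all_eq] := boolP [exists j, w j < z j]%N; last first.
  exists B; suff -> : z = w by [].
  by apply: funext => i; apply/eqP; rewrite eqn_leq leqNgt all_eq wz.
have [j [nlj wj wsum]] := growth_step zconn zM niso wz zw wl wj0.
have [|||B' [B'rep B'sc B'ker]] := @extend_rep C _ _ dsrc dinv n.+1 (@dart_invK Q)
    (fun i => ~~ looped i) w B j _ _ _ nlj Brep Bsc Bker.
- move=> x xj; apply: contraNneq nlj => xj'; rewrite -xj; apply: looped_dart.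
  by rewrite xj' xj.
- by rewrite (leq_trans wj) // (leq_trans (zn j)).
- move: wsum; rewrite -sum_darts //; congr (_ < _)%N; apply: eq_bigr => x _.
  by apply/esym/minn_idPr; rewrite (leq_trans (wz _)) // (leq_trans (zn _)).
apply: (IH _ B') B'rep B'sc B'ker => [|i|i zi|i li].
- apply: leq_trans wk; rewrite (bigD1 j) //= [leqRHS](bigD1 j) //= eqxx addn1.
  rewrite -addSn leq_add //; first by rewrite subnS prednK // subn_gt0.
  by apply: leq_sum => i _; rewrite leq_sub2l // leq_addr.
- by have [->|_] := eqVneq i j; rewrite ?addn1 ?addn0.
- by rewrite addn_eq0 negb_and zw.
- by have [ij|_] := eqVneq i j; rewrite ?addn0 ?wl //; rewrite ij (negPf nlj) in li.
Qed.

Lemma exists_base_rep w : supp_connected w ->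
  (forall i, ~~ looped i -> (w i <= 1)%N) ->
  exists B : dart Q -> 'M[C]_n.+1,
    padded_rep dsrc dinv w B /\ scalar_commutant dsrc dinv w B.
Proof.
move=> wconn wl; exists (base_dart C n w); split; first exact: base_padded.
exact: base_scalar.
Qed.

Lemma exists_rep z : (forall i, z i <= n)%N -> supp_connected z ->
  (forall j, z j <= \sum_i z i * arrows_between i j)%N ->
  ~ quiver_iso (supp z) one_arrow ->
  exists B : dart Q -> 'M[C]_n.+1,
    padded_rep dsrc dinv z B /\ scalar_commutant dsrc dinv z B.
Proof.
move=> zn zconn zM niso.
pose w i := if looped i then z i else minn 1 (z i).
have w0 i : (w i != 0%N) = (z i != 0%N).
  by rewrite /w; case: ifP => // _; rewrite -!lt0n leq_min.
have wl i : ~~ looped i -> (w i <= 1)%N.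
  by rewrite /w => /negPf ->; rewrite geq_minl.
apply: (@grow_rep z w (base_dart C n w)) => //.
- by move=> i; rewrite /w; case: ifP => // _; rewrite geq_minr.
- by move=> i; rewrite w0.
- by move=> i; rewrite /w => ->.
- exact: base_padded.
- apply: base_scalar => // i j; rewrite !w0 => zi zj.
  have -> : connect (supp_adj w) i j = connect (supp_adj z) i j.
    by apply: eq_connect => k l; rewrite /supp_adj /= !w0.
  exact: zconn.
(* If $z_i\ne0$, then $0<z_i\le(zM_Q)_i$ provides a dart from [i] to a vertex of the support. *)
move=> i li; have [wi0|wi] := eqVneq (w i) 0%N.
  by move=> v; rewrite wi0 pid_mx_0 mul0mx.
have : (0 < \sum_(x | dsrc x == i) z (dsrc (dinv x)))%N.
  by rewrite sum_darts // (leq_trans _ (zM i)) // lt0n -w0.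
rewrite lt0n sum_nat_eq0 negb_forall => /existsP[x]; rewrite negb_imply.
case/andP=> /eqP xi zx; rewrite -xi; apply: base_no_kernel; rewrite ?xi ?wl //.
by rewrite w0.
Qed.

End Existence.

(** * From padded matrices to indecomposable representations *)

Lemma unitarymx_adjM (C : numClosedFieldType) m n (S : 'M[C]_(m, n)) :
  m = n -> S \is unitarymx -> S^t* *m S = 1%:M.
Proof. by move=> mn; subst n => /unitarymxP/mulmx1C. Qed.

(** A splitting of [A] yields the orthogonal projection onto its first summand, which commutes with
    the arrows and, being self-adjoint, with their adjoints. It is therefore scalar. *)
Lemma padded_indecomposable (R : realType) (Q : quiver) (n : nat)
    (z : vertex Q -> nat) (B : dart Q -> 'M[R[i]]_n) :
  (forall i, z i <= n)%N -> ~ (forall i, z i = 0%N) ->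
  padded_rep (@dart_source Q) (@dart_inv Q) z B ->
  scalar_commutant (@dart_source Q) (@dart_inv Q) z B ->
  exists A : urep R z, indecomposable A.
Proof.
move=> zn z0 [Binv BE] Bsc.
pose P i : 'M[R[i]]_(z i, n) := pid_mx (z i).
pose Pa i : 'M[R[i]]_(n, z i) := pid_mx (z i).
have PPa i : P i *m Pa i = 1%:M.
  by rewrite /P /Pa pid_mx_id ?zn // pid_mx_1.
have PaP i : Pa i *m P i = pid_mx (z i) by rewrite /P /Pa pid_mx_id.
have adjP i : (P i)^t* = Pa i by exact: adjmx_pid.
have [A AE] : exists A : urep R z,
    forall a, A a = P (target a) *m B (a, false) *m Pa (source a).
  by exists (fun a => P (target a) *m B (a, false) *m Pa (source a)).
have EB a : pid_mx (z (target a)) *m B (a, false) = B (a, false).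
  have := BE (a, true); rewrite /dart_source /= => /(congr1 (fun M => M^t*)).
  by rewrite adjmxM adjmx_pid (Binv (a, false)) trmxCK.
have BA a : Pa (target a) *m A a *m P (source a) = B (a, false).
  by rewrite AE !mulmxA PaP EB -mulmxA PaP (BE (a, false)).
exists A; split=> // d1 d2 B1 B2 [zd [S [Su Sc]]].
have SaS i : (S i)^t* *m S i = 1%:M by rewrite unitarymx_adjM.
have SSa i : S i *m (S i)^t* = 1%:M by exact/unitarymxP.
pose D i : 'M[R[i]]_(d1 i + d2 i) := block_mx 1%:M 0 0 0.
have Da i : (D i)^t* = D i.
  by rewrite /D tr_block_mx map_block_mx !adjmx0 trmx1 map_mx1.
have [F FE] : exists F, forall i, F i = (S i)^t* *m D i *m S i.
  by exists (fun i => (S i)^t* *m D i *m S i).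
have Fa i : (F i)^t* = F i by rewrite FE !adjmxM trmxCK Da mulmxA.
have DB a : D (target a) *m dsum B1 B2 a = dsum B1 B2 a *m D (source a).
  rewrite /D /dsum !mulmx_block.
  by rewrite !mul1mx !mul0mx !mulmx0 !mulmx1 !addr0.
have FA a : F (target a) *m A a = A a *m F (source a).
  have Aa : A a = (S (target a))^t* *m dsum B1 B2 a *m S (source a).
    by rewrite -mulmxA -Sc mulmxA SaS mul1mx.
  rewrite Aa !FE -!mulmxA [S (target a) *m _]mulmxA SSa mul1mx.
  rewrite [S (source a) *m _]mulmxA SSa mul1mx !mulmxA.
  by rewrite -(mulmxA _ (D (target a))) DB !mulmxA.
have [i|x|c cH] := Bsc (fun i => Pa i *m F i *m P i).
- rewrite -!PaP -!mulmxA (mulmxA (P i) (Pa i)) PPa mul1mx.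
  by rewrite (mulmxA (P i) (Pa i)) PPa mul1mx.
- have fwd a : Pa (target a) *m F (target a) *m P (target a) *m B (a, false)
        = B (a, false) *m (Pa (source a) *m F (source a) *m P (source a)).
    rewrite -BA -!mulmxA (mulmxA (P (target a)) (Pa (target a))) PPa mul1mx.
    rewrite (mulmxA (P (source a)) (Pa (source a))) PPa mul1mx.
    by rewrite (mulmxA (F (target a))) FA !mulmxA.
  case: x => a []; rewrite /dart_source /=; last exact: fwd.
  have := congr1 (fun M => M^t*) (fwd a).
  rewrite (Binv (a, false)) !adjmxM !Fa -!adjP !trmxCK !mulmxA => ->.
  by [].
have DE i : D i = c%:M.
  have := cH i; rewrite -PaP => /(congr1 (fun M => S i *m (P i *m M *m Pa i) *m (S i)^t*)).
  rewrite /= -scalemxAr -!mulmxA -!scalemxAl -!scalemxAr -!mulmxA.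
  rewrite !(mulmxA (P i) (Pa i)) PPa !mul1mx FE SSa scalemx1 => <-.
  by rewrite -!mulmxA SSa mulmx1 mulmxA SSa mul1mx.
have [/existsP[i1 di1]|/existsPn d10] := boolP [exists i, d1 i != 0%N]; last first.
  by left=> i; apply/eqP/negPn.
have [/existsP[i2 di2]|/existsPn d20] := boolP [exists i, d2 i != 0%N]; last first.
  by right=> i; apply/eqP/negPn.
rewrite -lt0n in di1; rewrite -lt0n in di2.
(* Diagonal entries in the two blocks, possibly at different vertices, give $c=0$ and $c=1$. *)
have := (iffRL (matrixP _ _) (DE i2)) (rshift _ (Ordinal di2)) (rshift _ (Ordinal di2)).
have := (iffRL (matrixP _ _) (DE i1)) (lshift _ (Ordinal di1)) (lshift _ (Ordinal di1)).
rewrite block_mxEul block_mxEdr !mxE !eqxx => <- /eqP.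
by rewrite eq_sym oner_eq0.
Qed.

Lemma D_indecomposable (R : realType) (Q : quiver) (z : vertex Q -> nat) :
  D z -> exists A : urep R z, indecomposable A.
Proof.
move=> Dz; set n := \max_i z i.
have zn i : (z i <= n)%N by exact: leq_bigmax.
suff [z0 [B [Brep Bsc]]] : ~ (forall i, z i = 0%N) /\
    exists B : dart Q -> 'M[R[i]]_n.+1, padded_rep (@dart_source Q) (@dart_inv Q) z B
      /\ scalar_commutant (@dart_source Q) (@dart_inv Q) z B.
  by apply: (padded_indecomposable _ z0 Brep Bsc) => i; rewrite (leq_trans (zn i)).
case: Dz => [[i zi]|[i [j [mij zij]]]|[[i zi] zconn _ niso zM]].
- have z1 k : z k != 0%N -> k = i.
    by rewrite zi /unit_vector; have [->|_] := eqVneq k i.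
  split=> [/(_ i)|]; first by rewrite zi /unit_vector eqxx.
  apply: exists_base_rep => [k l /z1 -> /z1 ->|k _]; first exact: connect0.
  by rewrite zi /unit_vector; case: eqP.
- have z1 k : z k != 0%N -> k = i \/ k = j.
    rewrite zij /unit_vector; have [->|_] := eqVneq k i; first by left.
    by have [->|_] := eqVneq k j; first by right.
  have zi : z i != 0%N by rewrite zij /unit_vector eqxx.
  have zj : z j != 0%N by rewrite zij /unit_vector eqxx addn_eq0 andbF.
  split=> [/(_ i) /eqP|]; first exact/negP.
  apply: exists_base_rep => [k l /z1 kij /z1 lij|k lk].
    case: kij => ->; case: lij => ->; try exact: connect0; apply: connect1.
      by apply/and3P; rewrite mij.
    by apply/and3P; rewrite arrows_betweenC mij.
  rewrite zij /unit_vector; have [ki|_] := eqVneq k i; last by case: eqP.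
  (* Here $i=j$ and the dimension is $2e_i$; but $m_{ii}=1$ means a loop at [i], against [lk]. *)
  have [kj|//] := eqVneq k j.
  by move: lk; rewrite loopedE ki -[in X in arrows_between _ X]ki kj mij.
- split=> [/(_ i) /eqP|]; first exact/negP.
  by apply: exists_rep => //; apply/connected_supp.
Qed.

(** * Necessity *)

Section Necessity.
Variables (R : realType) (Q : quiver) (z : vertex Q -> nat) (A : urep R z).
Hypothesis Aind : indecomposable A.

(** Orthonormal bases of the row space of [M i] and of its orthogonal complement form a unitary
    matrix, and the stability assumptions make the transformed [A] block diagonal. *)
Lemma indecomposable_split (M : forall i, 'M[R[i]]_(z i)) :
  (forall a, M (target a) *m A a <= M (source a))%MS ->
  (forall a, M (source a) *m (A a)^t* <= M (target a))%MS ->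
  (forall i, \rank (M i) = 0%N) \/ (forall i, \rank (M i) = z i).
Proof.
move=> MA MAa.
pose Mo i := orthomx Num.conj (mx_of_hermitian (hermitian1mx _)) (M i).
pose U i := schmidt (row_base (M i)).
pose W i := schmidt (row_base (Mo i)).
have UM i : (U i :=: M i)%MS.
  by apply: eqmx_trans (eqmx_schmidt_free (row_base_free _)) (eq_row_base _).
have WM i : (W i :=: Mo i)%MS.
  by apply: eqmx_trans (eqmx_schmidt_free (row_base_free _)) (eq_row_base _).
have MW i : M i *m (W i)^t* = 0.
  have /orthomx1P : (W i <= Mo i)%MS by rewrite WM.
  by move=> /(congr1 (fun K => K^t*)); rewrite adjmxM trmxCK adjmx0.
have zE i : (\rank (M i) + \rank (Mo i))%N = z i by exact: add_rank_ortho.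
pose S i := col_mx (U i) (W i).
have Su i : S i \is unitarymx by exact: schmidt_complete_unitarymx.
have SaS i : (S i)^t* *m S i = 1%:M by rewrite unitarymx_adjM ?zE.
(* The off-diagonal blocks vanish: stability keeps the rows inside [M], which is orthogonal to
   [W]. *)
have UAW a : U (target a) *m A a *m (W (source a))^t* = 0.
  have /submxP[X ->] : (U (target a) *m A a <= M (source a))%MS.
    by apply: submx_trans (MA a); rewrite submxMr ?UM.
  by rewrite -mulmxA MW mulmx0.
have WAU a : W (target a) *m A a *m (U (source a))^t* = 0.
  have /submxP[X XE] : (U (source a) *m (A a)^t* <= M (target a))%MS.
    by apply: submx_trans (MAa a); rewrite submxMr ?UM.
  rewrite -[LHS]trmxCK -mulmxA adjmxM adjmxM trmxCK XE.
  by rewrite -mulmxA MW mulmx0 adjmx0.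
pose B : urep R (fun i => \rank (M i)) :=
  fun a => U (target a) *m A a *m (U (source a))^t*.
pose B' : urep R (fun i => \rank (Mo i)) :=
  fun a => W (target a) *m A a *m (W (source a))^t*.
have [|r0|r0] := Aind.2 _ _ B B'.
- split=> [i|]; first by rewrite zE.
  exists S; split=> // a.
  rewrite -[LHS]mulmx1 -SaS mulmxA; congr (_ *m _).
  rewrite /S tr_col_mx map_row_mx mul_col_mx mul_col_row.
  by rewrite UAW WAU.
- by left.
- by right=> i; rewrite -[RHS]zE r0 addn0.
Qed.

Lemma indecomposable_neq0 : exists i, z i != 0%N.
Proof.
have [/existsP[i zi]|/existsPn z0] := boolP [exists i, z i != 0%N]; first by exists i.
by case: Aind.1 => i; apply/eqP/negPn.
Qed.

Lemma arrow_eq0 a : (z (source a) == 0%N) || (z (target a) == 0%N) -> A a = 0.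
Proof.
move=> z0; apply/eqP; rewrite -mxrank_eq0 -leqn0.
by case/orP: z0 => /eqP <-; [apply: rank_leq_col | apply: rank_leq_row].
Qed.

(** The stable family is everything on the component of [i0] and zero elsewhere; a nonzero arrow
    never leaves a component. *)
Lemma indecomposable_connected : supp_connected z.
Proof.
move=> i0 j zi zj.
pose M i : 'M[R[i]]_(z i) := if connect (supp_adj z) i0 i then 1%:M else 0.
have Mst a : A a != 0 ->
    connect (supp_adj z) i0 (source a) = connect (supp_adj z) i0 (target a).
  move=> Aa; have [zs zt] : z (source a) != 0%N /\ z (target a) != 0%N.
    by split; apply: contraNneq Aa => za; rewrite arrow_eq0 // za eqxx ?orbT.
  have mst : (0 < arrows_between (source a) (target a))%N.
    by apply/card_gt0P; exists a; rewrite inE !eqxx.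
  apply/idP/idP => /connect_trans; apply; apply: connect1; apply/and3P; split=> //.
  by rewrite arrows_betweenC.
have [a|a|M0|M1] := @indecomposable_split M.
- have [->|/Mst Aa] := eqVneq (A a) 0; first by rewrite mulmx0 sub0mx.
  by rewrite /M Aa; case: ifP => _; rewrite ?submx1 // mul0mx sub0mx.
- have [->|/Mst Aa] := eqVneq (A a) 0; first by rewrite adjmx0 mulmx0 sub0mx.
  by rewrite /M Aa; case: ifP => _; rewrite ?submx1 // mul0mx sub0mx.
- by have := M0 i0; rewrite /M connect0 mxrank1 => zi0; rewrite zi0 in zi.
have := M1 j; rewrite /M; case: ifP => // _; rewrite mxrank0 => zj0.
by rewrite -zj0 in zj.
Qed.

(** If the bound fails at [j], the images at [j] span a proper subspace; together with the full
    spaces elsewhere it is stable. *)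
Lemma indecomposable_bound : ~ (exists i, z =1 unit_vector i) ->
  forall j, (z j <= \sum_i z i * arrows_between i j)%N.
Proof.
move=> nunit j; rewrite leqNgt; apply/negP => ltz.
have nl : ~~ looped j.
  apply: contraTN ltz; rewrite loopedE -leqNgt => m0.
  by rewrite (bigD1 j) //= (leq_trans (leq_pmulr _ m0)) ?leq_addr.
(* [pid_mx (z i)] is the identity in the only case used, where [i] is the source
   of the dart; it serves as a cast. *)
pose K1 (x : dart Q) i : 'M[R[i]]_(z i) :=
  if x.2 then <<(A x.1)^t* *m pid_mx (z i)>>%MS else <<A x.1 *m pid_mx (z i)>>%MS.
pose K i : 'M[R[i]]_(z i) := (\sum_(x : dart Q | dart_source x == i) K1 x i)%MS.
pose M i : 'M[R[i]]_(z i) := if i == j then K i else 1%:M.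
have AK a : (A a <= K (source a))%MS.
  apply: (sumsmx_sup (a, false)) => //; rewrite /K1 /= genmxE.
  by rewrite pid_mx_1 mulmx1.
have AaK a : ((A a)^t* <= K (target a))%MS.
  apply: (sumsmx_sup (a, true)) => //; rewrite /K1 /= genmxE.
  by rewrite pid_mx_1 mulmx1.
have rkK : (\rank (K j) < z j)%N.
  apply: leq_ltn_trans ltz; rewrite -sum_darts // /K.
  elim/big_rec2: _ => [|x m N _ IH]; first by rewrite mxrank0.
  apply: leq_trans (mxrank_adds_leqif _ _) _; rewrite leq_add //.
  case: x => a []; rewrite /K1 /dart_source /= genmxE;
    by rewrite (leq_trans (mxrankM_maxl _ _)) ?rank_leq_row.
have [a|a|M0|M1] := @indecomposable_split M.
- rewrite [X in (_ <= X)%MS]/M; case: ifP => _; last exact: submx1.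
  by rewrite (submx_trans (submxMl _ _)).
- rewrite [X in (_ <= X)%MS]/M; case: ifP => _; last exact: submx1.
  by rewrite (submx_trans (submxMl _ _)).
(* Now the dimension is concentrated at [j] and all arrows vanish, so any line splits off and
   $z=e_j$. *)
- have z0 i : i != j -> z i = 0%N.
    by move=> /negPf ij; have := M0 i; rewrite /M ij mxrank1.
  have A0 a : A a = 0.
    have [sj|sj] := eqVneq (source a) j; last by rewrite arrow_eq0 // z0.
    apply/eqP; rewrite -mxrank_eq0 -leqn0 (leq_trans (mxrankS (AK a))) //.
    by have := M0 (source a); rewrite /M sj eqxx => ->.
  have zj : (0 < z j)%N by exact: leq_ltn_trans ltz.
  have [a|a|P0|P1] := @indecomposable_split (fun i => pid_mx 1).
  + by rewrite A0 mulmx0 sub0mx.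
  + by rewrite A0 adjmx0 mulmx0 sub0mx.
  + by have := P0 j; rewrite rank_pid_mx.
  apply: nunit; exists j => i; rewrite /unit_vector.
  have [->|/z0 ->//] := eqVneq i j.
  by rewrite -P1 rank_pid_mx.
by have := M1 j; rewrite /M eqxx => rk; rewrite rk ltnn in rkK.
Qed.

(** A row eigenvector $v$ of $A^*A$ and its image $vA^*$ span a stable family, so both dimensions
    are one. *)
Lemma indecomposable_one_arrow : quiver_iso (supp z) one_arrow ->
  exists i j, arrows_between i j = 1%N /\
    z =1 (fun k => unit_vector i k + unit_vector j k)%N.
Proof.
move=> [f [g [fbij gbij fs ft]]].
have [g' gK g'K] := gbij.
pose a' := g' tt; pose a0 := val a'.
(* [one_arrow] has a single arrow, so [a0] is the only arrow of [Q] inside the support. *)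
have az (a : arrow Q) : z (source a) != 0%N -> z (target a) != 0%N -> a = a0.
  move=> zs zt; have azz : (z (source a) != 0%N) && (z (target a) != 0%N) by rewrite zs.
  rewrite -[a]/(val (exist _ a azz : arrow (supp z))); congr val.
  by apply: (can_inj gK); case: (g _); case: (g _).
have /andP[zs zt] : (z (source a0) != 0%N) && (z (target a0) != 0%N) := valP a'.
have fs0 : f (source a') = false by rewrite -fs.
have ft0 : f (target a') = true by rewrite -ft.
have st : target a0 != source a0.
  apply/eqP => e; have : f (target a') = f (source a') by congr f; apply: val_inj.
  by rewrite fs0 ft0.
have zst k : z k != 0%N -> k = source a0 \/ k = target a0.
  move=> zk; pose k' : vertex (supp z) := exist _ k zk.
  case fk : (f k'); [right | left].
    have := bij_inj fbij (etrans fk (esym ft0)); by move/(congr1 val).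
  have := bij_inj fbij (etrans fk (esym fs0)); by move/(congr1 val).
have [mu /eigenvalueP[v vE v0]] : exists mu, eigenvalue ((A a0)^t* *m A a0) mu.
  by apply: eigenvalue_closed; rewrite lt0n.
pose M i : 'M[R[i]]_(z i) :=
  if i == source a0 then <<v *m pid_mx (z i)>>%MS else
  if i == target a0 then <<v *m (A a0)^t* *m pid_mx (z i)>>%MS else 0.
have Ms : (M (source a0) :=: v)%MS.
  by rewrite /M eqxx pid_mx_1 mulmx1; apply: genmxE.
have Mt : (M (target a0) :=: v *m (A a0)^t*)%MS.
  by rewrite /M (negPf st) eqxx pid_mx_1 mulmx1; apply: genmxE.
have Aa a : a != a0 -> A a = 0.
  move=> aa0; apply: arrow_eq0; apply: contraNT aa0.
  by rewrite negb_or => /andP[zsa zta]; apply/eqP; apply: az.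
have [a|a|M0|M1] := @indecomposable_split M.
- have [->|/Aa ->] := eqVneq a a0; last by rewrite mulmx0 sub0mx.
  by rewrite Ms (eqmxMr _ Mt) -mulmxA vE scalemx_sub.
- have [->|/Aa ->] := eqVneq a a0; last by rewrite adjmx0 mulmx0 sub0mx.
  by rewrite Mt (eqmxMr _ Ms).
- by have := M0 (source a0); rewrite Ms => /eqP; rewrite mxrank_eq0 (negPf v0).
exists (source a0), (target a0); split.
  rewrite -[RHS](cards1 a0); apply: eq_card => a; rewrite !inE.
  apply/idP/eqP => [|->]; last by rewrite !eqxx.
  by case/orP => /andP[/eqP sa /eqP ta]; apply: az; rewrite ?sa ?ta.
have z1 k : z k != 0%N -> z k = 1%N.
  move=> zk; apply/eqP; rewrite eqn_leq lt0n zk andbT -M1.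
  by case: (zst k zk) => ->; rewrite ?Ms ?Mt rank_leq_row.
move=> k; rewrite /unit_vector; have [->|ks] := eqVneq k (source a0).
  by rewrite eq_sym (negPf st) z1.
have [->|kt] := eqVneq k (target a0); first by rewrite z1.
by apply/eqP/negPn/negP => /zst []; apply/eqP.
Qed.

Lemma indecomposable_D : D z.
Proof.
have [|nunit] := EM (exists i, z =1 unit_vector i); first by constructor 1.
have [/indecomposable_one_arrow|niso] := EM (quiver_iso (supp z) one_arrow).
  by constructor 2.
have zM := indecomposable_bound nunit.
constructor 3; split=> //.
- exact: indecomposable_neq0.
- exact/connected_supp/indecomposable_connected.
(* By $0<z_j\le(zM_Q)_j$ the support contains an arrow at [j], which [g] would send into [void]. *)
move=> [f [g _]]; have [j zj] := indecomposable_neq0.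
have [/existsP[i /andP[zi /card_gt0P[a]]]|/existsPn none] :=
    boolP [exists i, (z i != 0) && (0 < arrows_between i j)]%N.
  rewrite inE => aP.
  have az : (z (source a) != 0%N) && (z (target a) != 0%N).
    by case/orP: aP => /andP[/eqP -> /eqP ->]; rewrite zi zj.
  by case: (g (exist _ a az)).
have := zM j; rewrite big1 ?leqn0 ?(negPf zj) // => i _.
have := none i; rewrite negb_and negbK -eqn0Ngt.
by case/orP => /eqP ->; rewrite ?mul0n ?muln0.
Qed.

End Necessity.

Theorem theorem3p2 (R : realType) (Q : quiver) (z : vertex Q -> nat) :
  (exists A : urep R z, indecomposable A) <-> D z.
Proof.
by split=> [[A]|]; [apply: indecomposable_D | apply: D_indecomposable].
Qed.
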